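(* Let $\kappa>1$ and let $W$ be a random matrix with $d$ independent columns $We_1,\dots,We_d$ such that $\mathbb{E}\|We_i\|_2^2$ exists and moreover, for some $\beta,C>0$, $$\mathbb{E}\|We_i\|_2^{2+\beta}\le\left(C\,\mathbb{E}\|We_i\|_2^2\right)^{1+\beta/2}$$ for every $i\in\{1,\dots,d\}$. Then there exists an absolute constant $c>0$ such that $$\mathbb{P}\left(\mathcal{B}_\kappa(W)\ge C\,\mathbb{E}\|W\|_{HS}^2\right)\le (c\kappa)^{-(2+\beta)d}.$$
   Context: For a matrix $M$ with $d$ columns $M_1,\dots,M_d$ and $\kappa>1$, the regularized Hilbert-Schmidt norm is $$\mathcal{B}_\kappa(M)=\min\left\{\sum_{i=1}^d\alpha_i^2\|M_i\|_2^2:\ \alpha\in[0,1]^d,\ \prod_{i=1}^d\alpha_i\ge\kappa^{-d}\right\}.$$ $\|W\|_{HS}=\big(\sum_{i,j}w_{ij}^2\big)^{1/2}$ is the Hilbert-Schmidt norm, and $e_1,\dots,e_d$ is the standard basis of $\mathbb{R}^d$.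
   Formalization: The formal theorem also assumes that the expectation of the squared Hilbert-Schmidt norm of W is positive; for W = 0 almost surely the event has probability 1, so the claim fails for every absolute constant c once cκ > 1. *)

(* Defs.v *)
From HB Require Import structures.
From mathcomp Require Import all_boot all_order all_algebra.
From mathcomp Require Import all_classical all_reals all_analysis.

Set Implicit Arguments.
Unset Strict Implicit.
Unset Printing Implicit Defensive.
Import Order.TTheory GRing.Theory Num.Theory.
Import numFieldNormedType.Exports.

Local Open Scope classical_set_scope.
Local Open Scope ring_scope.

Definition l2norm (R : realType) (n : nat) (v : 'cV[R]_n) : R :=
  Num.sqrt (\sum_(i < n) v i 0 ^+ 2).

Definition HSnorm (R : realType) (n d : nat) (M : 'M[R]_(n, d)) : R :=
  Num.sqrt (\sum_(i < n) \sum_(j < d) M i j ^+ 2).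

Definition regHS_weights (R : realType) (d : nat) (kappa : R) : set 'rV[R]_d :=
  [set a | (forall j, 0 <= a 0 j <= 1) /\ kappa ^- d <= \prod_(j < d) a 0 j].

Definition regHS_obj (R : realType) (n d : nat) (M : 'M[R]_(n, d))
    (a : 'rV[R]_d) : R :=
  \sum_(j < d) a 0 j ^+ 2 * l2norm (col j M) ^+ 2.

(* The infimum is a minimum when 1 < kappa, by regHSP below. *)
Definition regHS (R : realType) (n d : nat) (kappa : R) (M : 'M[R]_(n, d)) : R :=
  inf (regHS_obj M @` regHS_weights kappa).

(* The columns of a random matrix take values in the measurable space of
   n-tuples, whose sigma-algebra is the product one; matrices themselves carry
   no measurable structure. *)
Definition col_tuple (R : realType) (n d : nat) (M : 'M[R]_(n, d)) (j : 'I_d) :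
  n.-tuple R := [tuple M i j | i < n].

Definition random_matrix (disp : measure_display) (T : measurableType disp)
    (R : realType) (n d : nat) (W : T -> 'M[R]_(n, d)) : Prop :=
  forall i j, measurable_fun [set: T] (fun t => W t i j).

Definition mutually_independent (disp disp' : measure_display)
    (T : measurableType disp) (T' : measurableType disp') (R : realType)
    (P : probability T R) (I : finType) (X : I -> T -> T') : Prop :=
  forall (J : {set I}) (B : I -> set T'), (forall i, measurable (B i)) ->
    P (\bigcap_(i in [set` J]) (X i @^-1` B i)) =
    (\prod_(i in J) P (X i @^-1` B i))%E.

Lemma regHSP (R : realType) (n d : nat) (kappa : R) (M : 'M[R]_(n, d)) :
  1 < kappa ->
  exists a, [/\ regHS_weights kappa a, regHS_obj M a = regHS kappa M &
    forall b, regHS_weights kappa b -> regHS_obj M a <= regHS_obj M b].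
Proof.
move=> k1; set A := @regHS_weights R d kappa.
have c0 (j : 'I_d) : continuous (fun a : 'rV[R]_d => a 0 j).
  exact: coord_continuous.
have cprod : continuous (fun a : 'rV[R]_d => \prod_(j < d) a 0 j).
  apply: continuous_big => [|j _]; last exact: c0.
  exact: mul_continuous.
have cobj : continuous (regHS_obj M).
  have cM (f g : 'rV[R]_d -> R) :
    continuous f -> continuous g -> continuous (fun a => f a * g a).
    by move=> cf cg x; exact: (continuousM (cf x) (cg x)).
  have cD (f g : 'rV[R]_d -> R) :
    continuous f -> continuous g -> continuous (fun a => f a + g a).
    by move=> cf cg x; exact: (continuousD (cf x) (cg x)).
  have ck (k : R) : continuous (fun _ : 'rV[R]_d => k).
    by move=> x; exact: cst_continuous.
  rewrite /regHS_obj; elim: (index_enum _) => [|j s IHs].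
    by under eq_fun do rewrite big_nil; exact: ck.
  under eq_fun do rewrite big_cons expr2.
  by apply: (cD) => //; apply: (cM) => //; apply: (cM); exact: c0.
have A0 : A !=set0.
  exists (const_mx 1); split=> [j|]; first by rewrite mxE ler01 lexx.
  rewrite big1 => [|j _]; last by rewrite mxE.
  by rewrite invf_le1 ?exprn_ege1 ?exprn_gt0 ?(lt_trans ltr01 k1)// ltW.
have cA : compact A.
  apply: (@subclosed_compact _ _
      [set a : 'rV[R]_d | forall j, a ord0 j \in `[0, 1]]).
  - have -> : A = (\bigcap_(j in [set: 'I_d])
        ((fun a : 'rV[R]_d => a 0 j) @^-1` `[0, 1])) `&`
        ((fun a : 'rV[R]_d => \prod_(j < d) a 0 j) @^-1` `[kappa ^- d, +oo[).
      apply/seteqP; split=> a /= [a01 ak]; split.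
      + by move=> j _ /=; rewrite in_itv/=; exact: a01.
      + by rewrite in_itv/= ak.
      + by move=> j; have := a01 j I; rewrite /= in_itv.
      + by move: ak; rewrite in_itv/= andbT.
    apply: closedI.
      apply: closed_bigI => j _; apply: preimage_closed => [x _|]; first exact: c0.
      exact: interval_closed.
    by apply: preimage_closed => [x _|]; [exact: cprod|exact: interval_closed].
  - apply: (@rV_compact _ _ (fun=> `[0%R, 1%R : R]%classic)) => _.
    exact: segment_compact.
  - by move=> a [a01 _] j; rewrite in_itv/=; exact: a01.
have [a] := EVT_min_rV A0 cA (continuous_subspaceT cobj).
rewrite inE => Aa amin.
have amin' b : A b -> regHS_obj M a <= regHS_obj M b.
  by move=> Ab; apply: amin; rewrite inE.
exists a; split=> //; apply/eqP; rewrite eq_le; apply/andP; split.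
  apply: lb_le_inf; first by exists (regHS_obj M a), a.
  by move=> _ [b Ab <-]; exact: amin'.
apply: ge_inf; last by exists a.
by exists (regHS_obj M a) => _ [b Ab <-]; exact: amin'.
Qed.

(* Main.v *)
(* Put X_j = ||W e_j||^2, u_j = C E X_j and p = 1 + beta/2.  If
   B_kappa(W) >= sum_j u_j, then prod_j max(1, X_j/u_j) >= kappa^(2d), since
   otherwise weights slightly smaller than max(1, X_j/u_j)^(-1/2) would be
   admissible and give a smaller value.  By the moment hypothesis
   E max(1, X_j/u_j)^p <= 1 + E (X_j/u_j)^p <= 2, so independence and Markov's
   inequality bound the probability by 2^d kappa^(-2pd), and c = 1/2 works
   because 2p = 2 + beta >= 1.  When u_j = 0, division by zero gives
   X_j/u_j = 0, which is harmless since X_j = 0 almost surely. *)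
Require Import Defs.
From HB Require Import structures.
From mathcomp Require Import all_boot all_order all_algebra.
From mathcomp Require Import all_classical all_reals all_analysis.
From mathcomp Require Import measurable_realfun ring lra.
Import Order.TTheory GRing.Theory Num.Theory.
Import numFieldNormedType.Exports.
Import HBNNSimple.

Local Open Scope classical_set_scope.
Local Open Scope ring_scope.

(** * Expectations of products of independent variables *)

(** [g] is a finite combination of indicators of its level sets, and the hypothesis applies to each
    of them. *)
Lemma integral_mul_nnsfun (disp disp' : measure_display)
    (T : measurableType disp) (T' : measurableType disp') (R : realType)
    (P : {measure set T -> \bar R}) (Z : T -> R) (X : T -> T')
    (k : R) (g : {nnsfun T' >-> R}) :
  measurable_fun [set: T] Z -> (forall t, 0 <= Z t) ->
  measurable_fun [set: T] X ->
  (forall B, measurable B ->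
    (\int[P]_t (Z t * \1_B (X t))%:E = k%:E * P (X @^-1` B))%E) ->
  (\int[P]_t (Z t * g (X t))%:E =
   \sum_(r \in range g) (k * r)%:E * P (X @^-1` (g @^-1` [set r])))%E.
Proof.
move=> mZ Z0 mX ZX.
have mZ1 r : measurable_fun [set: T] (fun t => Z t * \1_(g @^-1` [set r]) (X t)).
  apply: measurable_funM => //.
  by apply: (measurableT_comp _ mX); exact: measurable_indic.
transitivity (\int[P]_t (\sum_(r \in range g)
    (r * (Z t * \1_(g @^-1` [set r]) (X t)))%:E))%E.
  apply: eq_integral => t _.
  rewrite fsumEFin// [in LHS](fimfunE g (X t)) mulrC fsbig_finite//=.
  rewrite [in RHS]fsbig_finite//= mulr_suml; congr (_%:E).
  by apply: eq_bigr => r _; rewrite -mulrA (mulrC _ (Z t)).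
rewrite ge0_integral_fsum//; last 2 first.
- by move=> r; apply/measurable_EFinP; exact: measurable_funM.
- move=> r t _; have := nnfun_muleindic_ge0 g r (X t).
  by rewrite !lee_fin mulrCA => ?; rewrite mulr_ge0.
apply: eq_fsbigr => r; rewrite inE => -[x _ <-].
rewrite mulrC EFinM -muleA -ZX// -ge0_integralZl//.
- by apply/measurable_EFinP; exact: mZ1.
- by move=> t _; rewrite lee_fin mulr_ge0.
- by rewrite lee_fin.
Qed.

(** Simple functions increase to [f], so monotone convergence extends the identity from indicators.
    When [P] is a probability, [B := setT] shows that [k] is the expectation of [Z]. *)
Lemma ge0_integral_mul_indep (disp disp' : measure_display)
    (T : measurableType disp) (T' : measurableType disp') (R : realType)
    (P : {measure set T -> \bar R}) (Z : T -> R) (X : T -> T') (k : R)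
    (f : T' -> R) :
  measurable_fun [set: T] Z -> (forall t, 0 <= Z t) ->
  measurable_fun [set: T] X ->
  (forall B, measurable B ->
    (\int[P]_t (Z t * \1_B (X t))%:E = k%:E * P (X @^-1` B))%E) ->
  measurable_fun [set: T'] f -> (forall x, 0 <= f x) ->
  (\int[P]_t (Z t * f (X t))%:E = k%:E * \int[P]_t (f (X t))%:E)%E.
Proof.
move=> mZ Z0 mX ZX mf f0.
have mfE : measurable_fun [set: T'] (fun x => (f x)%:E).
  exact/measurable_EFinP.
pose h := nnsfun_approx measurableT mfE.
have mhX n : measurable_fun [set: T] (fun t => h n (X t)).
  exact: measurableT_comp.
have hf x : (h n x)%:E @[n --> \oo] --> (f x)%:E.
  by apply: (cvg_nnsfun_approx measurableT mfE) => // y _; rewrite lee_fin.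
have nd_h x : {homo (fun n => h n x) : m n / (m <= n)%N >-> m <= n}.
  by move=> m n mn; exact/lefP/nd_nnsfun_approx.
(* The weight [Y] is [Z] for the left-hand side and the constant 1 for the right-hand side. *)
have cvgZ (Y : T -> R) : measurable_fun [set: T] Y -> (forall t, 0 <= Y t) ->
  (\int[P]_t (Y t * h n (X t))%:E)%E @[n --> \oo] -->
    (\int[P]_t (Y t * f (X t))%:E)%E.
  move=> mY Y0.
  have -> : (\int[P]_t (Y t * f (X t))%:E =
      \int[P]_t (limn (fun n => (Y t * h n (X t))%:E)))%E.
    apply: eq_integral => t _; apply/esym/cvg_lim => //.
    under eq_fun do rewrite EFinM.
    by rewrite EFinM; exact: cvgeZl.
  apply: cvg_monotone_convergence => //.
  - by move=> n; apply/measurable_EFinP; exact: measurable_funM.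
  - by move=> n t _; rewrite lee_fin mulr_ge0.
  - by move=> t _ m n mn; rewrite lee_fin ler_wpM2l ?nd_h.
have indic1 B : measurable B ->
    (\int[P]_t (cst 1 t * \1_B (X t))%:E = 1%:E * P (X @^-1` B))%E.
  move=> mB; under eq_integral do rewrite /= mul1r.
  have mXB : measurable (X @^-1` B).
    by rewrite -[X in measurable X]setTI; exact: mX.
  by rewrite mul1e -[in RHS](setIT (X @^-1` B)) -integral_indic.
have simple n : (\int[P]_t (Z t * h n (X t))%:E =
    k%:E * \int[P]_t (cst 1 t * h n (X t))%:E)%E.
  rewrite (@integral_mul_nnsfun _ _ _ _ _ _ Z _ k)//.
  rewrite (@integral_mul_nnsfun _ _ _ _ _ _ (cst 1) _ 1)//.
  rewrite !fsbig_finite//= big_seq [in RHS]big_seq ge0_sume_distrr => [|r].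
    by apply: eq_bigr => r _; rewrite muleA -EFinM mul1r.
  rewrite in_fset_set// inE => -[x _ <-].
  by rewrite mul1r mule_ge0// lee_fin.
have : (\int[P]_t (Z t * h n (X t))%:E)%E @[n --> \oo] -->
    (k%:E * \int[P]_t (f (X t))%:E)%E.
  under eq_fun do rewrite simple; apply: cvgeZl => //.
  under [X in _ --> X]eq_integral do rewrite -[f _]mul1r.
  exact: (cvgZ (cst 1)).
by move/cvg_lim => <- //; apply/esym/cvg_lim => //; exact: cvgZ.
Qed.

(* Induction on the list of indices whose [f i] is not an indicator: replacing
   one [f j] by indicators gives the hypothesis of [ge0_integral_mul_indep]. *)
Lemma integral_prod_indep (disp disp' : measure_display)
    (T : measurableType disp) (T' : measurableType disp') (R : realType)
    (P : probability T R) (I : finType) (X : I -> T -> T') (f : I -> T' -> R) :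
  (forall i, measurable_fun [set: T] (X i)) -> mutually_independent P X ->
  (forall i, measurable_fun [set: T'] (f i)) -> (forall i x, 0 <= f i x) ->
  (forall i, \int[P]_t (f i (X i t))%:E < +oo)%E ->
  (\int[P]_t (\prod_i f i (X i t))%:E = \prod_i \int[P]_t (f i (X i t))%:E)%E.
Proof.
move=> mX indX.
have mXB i B : measurable B -> measurable (X i @^-1` B).
  by move=> mB; rewrite -[X in measurable X]setTI; exact: mX.
have intX i B : measurable B ->
    (\int[P]_t (\1_B (X i t))%:E = P (X i @^-1` B))%E.
  move=> mB; rewrite -[in RHS](setIT (X i @^-1` B)) -integral_indic//.
  exact: mXB.
suff main (s : seq I) : forall f : I -> T' -> R,
    (forall i, measurable_fun [set: T'] (f i)) -> (forall i x, 0 <= f i x) ->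
    (forall i, \int[P]_t (f i (X i t))%:E < +oo)%E ->
    (forall i, i \notin s -> exists2 B, measurable B & f i = \1_B) ->
    (\int[P]_t (\prod_i f i (X i t))%:E =
     \prod_i \int[P]_t (f i (X i t))%:E)%E.
  move=> mf f0 foo; apply: (main (enum I)) => // i.
  by rewrite mem_enum.
elim: s => [|j s IH] {}f mf f0 foo fB.
  (* Base case: every factor is an indicator, so the product is the indicator of an intersection,
     and independence is used with the full index set. *)
  have {}fB i : exists B, measurable B /\ f i = \1_B.
    by have [B mB ->] := fB i isT; exists B.
  have {fB}[B fB] := choice fB.
  under [RHS]eq_bigr => i _.
    under eq_integral do rewrite (fB i).2.
    rewrite intX; last exact: (fB i).1.
  over.
  have := indX [set: I]%SET B (fun i => (fB i).1).
  under [X in _ = X -> _]eq_bigl do rewrite finset.in_setT.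
  move=> <-; set A := \bigcap_(i in _) _.
  have mA : measurable A.
    by apply: fin_bigcap_measurable => [|i _]; [exact: finite_finset|exact/mXB/(fB i).1].
  rewrite -[in RHS](setIT A) -integral_indic//.
  apply: eq_integral => t _; congr (_%:E).
  rewrite indicE; have [At|nAt] := pselect (A t).
    rewrite mem_set// big1// => i _; rewrite (fB i).2 indicE mem_set//.
    by apply: At => /=; rewrite finset.in_setT.
  have [i nBi] : exists i, ~ B i (X i t).
    by apply/existsNP => BX; apply: nAt => i _; exact: BX.
  by rewrite memNset// (bigD1 i)//= (fB i).2 indicE memNset// mul0r.
pose Z t := \prod_(i | i != j) f i (X i t).
(* Finiteness makes the product of the other expectations a real number [k], as
   [ge0_integral_mul_indep] demands. *)
have E_fin i : (\int[P]_t (f i (X i t))%:E)%E \is a fin_num.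
  by rewrite ge0_fin_numE// integral_ge0// => t _; rewrite lee_fin.
rewrite (bigD1 j)//=.
under eq_integral do rewrite (bigD1 j)//= -/(Z _) mulrC.
pose k := \prod_(i | i != j) fine (\int[P]_t (f i (X i t))%:E)%E.
have kE : (\prod_(i | i != j) \int[P]_t (f i (X i t))%:E = k%:E)%E.
  by rewrite -prodEFin; apply: eq_bigr => i _; rewrite fineK.
rewrite kE muleC; apply: ge0_integral_mul_indep => //.
- rewrite /Z; under eq_fun do rewrite big_mkcond /=.
  apply: measurable_prod => i _; case: (i != j) => //.
  exact: measurableT_comp.
- by move=> t; exact: prodr_ge0.
- move=> B mB.
  pose f' i := if i == j then \1_B else f i.
  have f'N i : i != j -> f' i = f i by rewrite /f' => /negbTE ->.
  have f'j : f' j = \1_B by rewrite /f' eqxx.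
  have := IH f'.
  rewrite (bigD1 j)//= f'j intX//.
  under eq_bigr => i ij do rewrite f'N//.
  rewrite kE muleC => <-.
  + apply: eq_integral => t _; rewrite [in RHS](bigD1 j)//= f'j mulrC.
    by congr (_ * _)%:E; apply: eq_bigr => i ij; rewrite f'N.
  + move=> i; have [->|ij] := eqVneq i j; last by rewrite f'N.
    by rewrite f'j; exact: measurable_indic.
  + by move=> i x; have [->|ij] := eqVneq i j; rewrite ?f'j// f'N.
  + move=> i; have [->|ij] := eqVneq i j; last by rewrite f'N.
    by rewrite f'j intX// (le_lt_trans (probability_le1 _ _)) ?ltry//; exact: mXB.
  + move=> i si; have [->|ij] := eqVneq i j; first by exists B.
    by rewrite f'N//; apply: fB; rewrite inE negb_or ij.
Qed.

(** * Real powers and the moment bound *)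

Lemma powR_prod (R : realType) (I : finType) (a : I -> R) (p : R) :
  (forall i, 0 <= a i) -> \prod_i a i `^ p = (\prod_i a i) `^ p.
Proof.
move=> a0.
suff [] : 0 <= \prod_i a i /\ \prod_i a i `^ p = (\prod_i a i) `^ p by [].
elim/big_rec2: _ => [|i x y _ [y0 ->]]; first by rewrite powR1 ler01.
by rewrite mulr_ge0// powRM.
Qed.

Lemma integral_max_powR_le2 (disp : measure_display) (T : measurableType disp)
    (R : realType) (P : probability T R) (X : T -> R) (u p : R) :
  0 <= p -> measurable_fun [set: T] X -> (forall t, 0 <= X t) -> 0 <= u ->
  (\int[P]_t (X t `^ p)%:E <= (u `^ p)%:E)%E ->
  (\int[P]_t (Num.max 1 (X t / u) `^ p)%:E <= 2%:E)%E.
Proof.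
move=> p0 mX X0 u0 EXp.
have mXp : measurable_fun [set: T] (fun t => X t `^ p).
  exact: (measurableT_comp (measurable_powR _) mX).
have mXu : measurable_fun [set: T] (fun t => u^-1 `^ p * X t `^ p).
  exact: measurable_funM.
have max_le z : 0 <= z -> Num.max 1 z `^ p <= 1 + z `^ p.
  move=> z0; case: (leP 1 z) => _; first by rewrite lerDr ler01.
  by rewrite powR1 lerDl powR_ge0.
apply: (@le_trans _ _ (\int[P]_t (1 + (u^-1 `^ p * X t `^ p)%:E))%E).
  apply: ge0_le_integral => //.
  - by move=> t _; rewrite lee_fin powR_ge0.
  - apply/measurable_EFinP; apply: (measurableT_comp (measurable_powR _)).
    apply: measurable_maxr => //; exact: measurable_funM.
  - by apply: emeasurable_funD => //; exact/measurable_EFinP.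
  - move=> t _; rewrite -EFinD lee_fin mulrC -powRM ?invr_ge0//.
    by rewrite max_le// mulr_ge0 ?invr_ge0.
rewrite ge0_integralD//; last 2 first.
- by move=> t _; rewrite lee_fin mulr_ge0// powR_ge0.
- exact/measurable_EFinP.
rewrite integral_cst// mul1e [X in (X + _)%E](_ : _ = 1%E); last exact: probability_setT.
under eq_integral do rewrite EFinM.
rewrite ge0_integralZl//; last 3 first.
- exact/measurable_EFinP.
- by move=> t _; rewrite lee_fin powR_ge0.
- by rewrite lee_fin powR_ge0.
rewrite (_ : 2%:E = 1 + 1)%E// leeD2l//.
apply: (le_trans (lee_wpmul2l _ EXp)); first by rewrite lee_fin powR_ge0.
rewrite -EFinM lee_fin -powRM ?invr_ge0//.
(* For [u = 0] the base is 0, and its power is 0, or 1 when [p = 0]; either is at most 1. *)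
have [->|uN0] := eqVneq u 0; last by rewrite mulVf// powR1.
have [->|pN0] := eqVneq p 0; first by rewrite powRr0.
by rewrite mulr0 powR0// ler01.
Qed.

(** * Norms and measurability of the event *)

Lemma l2norm_sqr (R : realType) (n : nat) (v : 'cV[R]_n) :
  l2norm v ^+ 2 = \sum_(i < n) v i 0 ^+ 2.
Proof. by rewrite sqr_sqrtr// sumr_ge0// => i _; rewrite sqr_ge0. Qed.

Lemma HSnorm_sqr (R : realType) (n d : nat) (M : 'M[R]_(n, d)) :
  HSnorm M ^+ 2 = \sum_(j < d) l2norm (col j M) ^+ 2.
Proof.
rewrite sqr_sqrtr; last first.
  by apply: sumr_ge0 => i _; apply: sumr_ge0 => j _; rewrite sqr_ge0.
rewrite exchange_big; apply: eq_bigr => j _; rewrite l2norm_sqr.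
by apply: eq_bigr => i _; rewrite mxE.
Qed.

Lemma measurable_l2norm_col (disp : measure_display) (T : measurableType disp)
    (R : realType) (n d : nat) (W : T -> 'M[R]_(n, d)) (j : 'I_d) :
  random_matrix W ->
  measurable_fun [set: T] (fun t => l2norm (col j (W t)) ^+ 2).
Proof.
move=> mW; under eq_fun do rewrite l2norm_sqr.
apply: measurable_sum => i; under eq_fun do rewrite mxE.
by apply: measurable_funX; exact: mW.
Qed.

(** Rounding the coordinates of a minimizer up to rationals in [[0, 1]] preserves the product
    constraint and raises the objective arbitrarily little. This reduces measurability to countably
    many weights. *)
Lemma regHS_lt_rat (R : realType) (n d : nat) (kappa s : R) (M : 'M[R]_(n, d)) :
  1 < kappa -> regHS kappa M < s ->
  exists q : 'rV[rat]_d, regHS_weights kappa (map_mx ratr q) /\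
    regHS_obj M (map_mx ratr q) < s.
Proof.
move=> k1; have [a [[a01 ak] <- _] as_]:= regHSP M k1.
pose x j := l2norm (col j M) ^+ 2.
pose S := \sum_(j < d) x j.
have x0 j : 0 <= x j by rewrite sqr_ge0.
have S0 : 0 <= S by exact: sumr_ge0.
(* For [a, e] in [[0, 1]], [(a + e)^2 <= a^2 + 3 e], so the objective grows by at most [3 e S], less
   than the gap to [s]. The [+ 1] covers [S = 0]. *)
pose e := Num.min 1 ((s - regHS_obj M a) / (3 * S + 1)).
have den0 : 0 < 3 * S + 1 by lra.
have e0 : 0 < e by rewrite lt_min ltr01 divr_gt0// subr_gt0.
have qE j : exists q : rat, 
      a 0 j <= (ratr q : R) <= 1 /\ (ratr q : R) <= a 0 j + e.
  have /andP[aj0 aj1] := a01 j.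
  (* A coordinate equal to 1 leaves no room above it, but is already rational. *)
  have [aj|aj] := eqVneq (a 0 j) 1.
    have r1 : ratr 1 = 1 :> R by exact: rmorph1.
    by exists 1; rewrite aj r1 !lexx lerDl ltW.
  have : a 0 j < Num.min 1 (a 0 j + e).
    by rewrite lt_min ltrDl e0 lt_neqAle aj aj1.
  move=> /rat_in_itvoo[q]; rewrite in_itv /= lt_min => /andP[q1 /andP[q2 q3]].
  by exists q; split; [apply/andP; split|]; exact: ltW.
have [q qP] := choice qE.
exists (\row_j q j); split; first split.
- move=> j; rewrite !mxE; have [/andP[aq ->] _] := qP j.
  by rewrite (le_trans _ aq)//; have /andP[] := a01 j.
- apply: (le_trans ak); apply: ler_prod => j _.
  by rewrite !mxE; have [/andP[-> _] _] := qP j; have /andP[->] := a01 j.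
apply: (@le_lt_trans _ _ (regHS_obj M a + 3 * e * S)).
  rewrite mulr_sumr -big_split /=; apply: ler_sum => j _.
  rewrite !mxE -/(x j) -mulrDl ler_wpM2r//.
  have [/andP[aq q1] qe] := qP j; have /andP[aj0 aj1] := a01 j.
  have e1 : e <= 1 by rewrite ge_min lexx.
  nra.
have : e * (3 * S + 1) <= s - regHS_obj M a.
  by rewrite -ler_pdivlMr// ge_min lexx orbT.
lra.
Qed.

Lemma measurable_regHS (disp : measure_display) (T : measurableType disp)
    (R : realType) (n d : nat) (W : T -> 'M[R]_(n, d)) (kappa s : R) :
  1 < kappa -> random_matrix W ->
  measurable [set t | s <= regHS kappa (W t)].
Proof.
move=> k1 mW.
have -> : [set t | s <= regHS kappa (W t)] = ~` \bigcup_(q : 'rV[rat]_d)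
    [set t | regHS_weights kappa (map_mx ratr q : 'rV[R]_d) /\
             regHS_obj (W t) (map_mx ratr q) < s].
  rewrite -[LHS]setCK; congr (~` _); apply/seteqP; split=> t /=.
    by move=> /negP; rewrite -ltNge => /regHS_lt_rat-/(_ k1)[q qP]; exists q.
  move=> [q _ [qW qs]]; apply/negP; rewrite -ltNge (le_lt_trans _ qs)//.
  have [a [_ <- amin]] := regHSP (W t) k1; exact: amin.
apply: measurableC; apply: countable_bigcupT_measurable => // q.
(* Admissibility does not depend on [t]: each set is empty or a sublevel set of a measurable
   function. *)
have [qW|qW] := pselect (regHS_weights kappa (map_mx ratr q : 'rV[R]_d)); last first.
  rewrite (_ : [set _ | _] = set0)//.
  by apply/seteqP; split=> // t [].
rewrite (_ : [set _ | _] = [set t | regHS_obj (W t) (map_mx ratr q) < s]); last first.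
  by apply/seteqP; split=> // t [].
have mobj : measurable_fun [set: T] (fun t => regHS_obj (W t) (map_mx ratr q)).
  rewrite /regHS_obj; apply: measurable_sum => j.
  by apply: measurable_funM => //; exact: measurable_l2norm_col.
have := mobj measurableT `]-oo, s[%classic (measurable_itv _).
rewrite setTI; congr (measurable _).
Qed.

(** * The deterministic inequality *)

Lemma regHS_ge_prod (R : realType) (n d : nat) (kappa : R) (M : 'M[R]_(n, d))
    (u : 'I_d -> R) :
  1 < kappa -> (forall j, 0 <= u j) -> 0 < \sum_j u j ->
  (forall j, u j = 0 -> l2norm (col j M) = 0) ->
  \sum_j u j <= regHS kappa M ->
  kappa ^+ (2 * d) <= \prod_j Num.max 1 (l2norm (col j M) ^+ 2 / u j).
Proof.
move=> k1 u0 su0 ux0 uM; rewrite leNgt; apply/negP => prod_lt.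
have k0 : 0 < kappa by exact: lt_trans k1.
pose m j := Num.max 1 (l2norm (col j M) ^+ 2 / u j).
have m1 j : 1 <= m j by rewrite le_max lexx.
have m0 j : 0 < m j by exact: lt_le_trans (m1 j).
have d0 : (0 < d)%N.
  by rewrite lt0n; apply: contraTneq su0 => d0; subst d; rewrite big_ord0 ltxx.
pose p := \prod_j m j; rewrite -/p in prod_lt.
have p0 : 0 < p by exact: prodr_gt0.
(* [r < 1] measures the slack in the product. Its [d]-th root [s] spreads that slack evenly: the
   weights [s / sqrt (m j)] have product exactly [kappa ^- d], and each term of the objective is at
   most [s^2 * u j]. *)
pose r := Num.sqrt p / kappa ^+ d.
have sp0 : 0 < Num.sqrt p by rewrite sqrtr_gt0.
have spE : \prod_j Num.sqrt (m j) = Num.sqrt p.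
  rewrite /p; elim/big_rec2: _ => [|j y z _ ->]; first by rewrite sqrtr1.
  by rewrite sqrtrM// ltW.
have r0 : 0 < r by rewrite divr_gt0// exprn_gt0.
have r1 : r < 1.
  rewrite ltr_pdivrMr ?exprn_gt0// mul1r.
  rewrite -(ltr_pXn2r (_ : 0 < 2)%N) ?nnegrE ?exprn_ge0 ?ltW//.
  by rewrite sqr_sqrtr ?ltW// -exprM mulnC.
pose s := r `^ d%:R^-1.
have sd : s ^+ d = r.
  by rewrite -powR_mulrn ?powR_ge0// -powRrM mulVf ?powRr1 ?ltW// pnatr_eq0 -lt0n.
have s0 : 0 < s by rewrite powR_gt0.
have s1 : s < 1.
  by rewrite ltNge; apply/negP => /(exprn_ege1 d); rewrite sd leNgt r1.
pose a : 'rV[R]_d := \row_j (s / Num.sqrt (m j)).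
have sm0 j : 0 < Num.sqrt (m j) by rewrite sqrtr_gt0.
have aW : regHS_weights kappa a.
  split=> [j|].
    rewrite mxE divr_ge0 ?ltW//= ltr_pdivrMr// mul1r (lt_le_trans s1)//.
    by rewrite -[leLHS]sqrtr1 ler_wsqrtr.
  under eq_bigr do rewrite mxE.
  rewrite big_split /= prodr_const card_ord sd prodfV spE /r mulrAC.
  by rewrite divff ?lt0r_neq0// mul1r.
have : regHS kappa M <= s ^+ 2 * \sum_j u j.
  have [b [_ <- bmin]] := regHSP M k1; apply: (le_trans (bmin _ aW)).
  rewrite mulr_sumr; apply: ler_sum => j _.
  rewrite mxE expr_div_n sqr_sqrtr ?(ltW (m0 j))// -mulrA ler_wpM2l ?sqr_ge0//.
  rewrite mulrC ler_pdivrMr// .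
  (* If [u j = 0] the ratio in [m j] carries no information, but the column vanishes. *)
  have [uj|uj] := eqVneq (u j) 0; first by rewrite uj ux0// expr0n/= mul0r.
  have uj0 : 0 < u j by rewrite lt_neqAle eq_sym uj u0.
  by rewrite mulrC -ler_pdivrMr// /m le_max lexx orbT.
apply/negP; rewrite -ltNge (lt_le_trans _ uM)//.
by rewrite gtr_pMl// expr_lt1// ltW.
Qed.

(* The constant c depends on nothing but the field of real numbers.  The
   hypothesis 0 < E ||W||_HS^2 excludes W = 0 almost surely, for which the event
   below is certain and no absolute c can work. *)
Theorem lemma6p5 (R : realType) :
  exists c : R, 0 < c /\
  forall (disp : measure_display) (T : measurableType disp)
    (P : probability T R) (n d : nat) (W : T -> 'M[R]_(n, d))
    (kappa beta C : R),
    1 < kappa -> 0 < beta -> 0 < C ->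
    random_matrix W ->
    mutually_independent P (fun j t => col_tuple (W t) j) ->
    (forall j : 'I_d, ('E_P[fun t => (l2norm (col j (W t)) ^+ 2)%R] < +oo)%E) ->
    (forall j : 'I_d,
      ('E_P[fun t => (l2norm (col j (W t)) `^ (2 + beta))%R] <=
       (C%:E * 'E_P[fun t => (l2norm (col j (W t)) ^+ 2)%R])
         `^ (1 + beta / 2)%R)%E) ->
    (0 < 'E_P[fun t => (HSnorm (W t) ^+ 2)%R])%E ->
    (P [set t | (C%:E * 'E_P[fun s => (HSnorm (W s) ^+ 2)%R] <=
                 (regHS kappa (W t))%:E)%E] <=
     ((c * kappa) `^ (- ((2 + beta) * d%:R)))%R%:E)%E.
Proof.
exists 2^-1; split; first by rewrite invr_gt0.
move=> disp T P n d W kappa beta C k1 b0 C0 mW indW EX2 EXp EHS.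
have EE (Y : T -> R) : ('E_P[Y] = \int[P]_t (Y t)%:E)%E by rewrite unlock.
pose X j t := l2norm (col j (W t)) ^+ 2.
have X0 j t : 0 <= X j t by rewrite sqr_ge0.
have mX j : measurable_fun [set: T] (X j) by exact: measurable_l2norm_col.
pose m j := fine 'E_P[X j].
have mE j : ('E_P[X j] = (m j)%:E)%E.
  by rewrite fineK// ge0_fin_numE ?EX2// expectation_ge0.
have m0 j : 0 <= m j by rewrite fine_ge0// expectation_ge0.
pose u j := C * m j.
have u0 j : 0 <= u j by rewrite mulr_ge0// ltW.
have HSE : ('E_P[fun t => (HSnorm (W t) ^+ 2)%R] = (\sum_j m j)%:E)%E.
  rewrite EE; under eq_integral do rewrite HSnorm_sqr -sumEFin.
  rewrite ge0_integral_sum//.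
  - by rewrite -sumEFin; apply: eq_bigr => j _; rewrite -mE EE.
  - by move=> j; apply/measurable_EFinP; exact: mX.
  - by move=> j t _; rewrite lee_fin; exact: X0.
have su0 : 0 < \sum_j u j.
  by rewrite -mulr_sumr mulr_gt0//; move: EHS; rewrite HSE lte_fin.
have -> : [set t | (C%:E * 'E_P[fun s => (HSnorm (W s) ^+ 2)%R] <=
    (regHS kappa (W t))%:E)%E] = [set t | \sum_j u j <= regHS kappa (W t)].
  by apply/seteqP; split=> t /=; rewrite HSE -EFinM lee_fin mulr_sumr.
set A := [set t | _].
have mA : measurable A by exact: measurable_regHS.
pose p := 1 + beta / 2.
have p0 : 0 < p by rewrite /p; lra.
(* Independence is about column tuples, so [Y j] is written as a measurable function [y j] of the
   [j]-th one. *)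
pose y (j : 'I_d) (v : n.-tuple R) :=
  Num.max 1 ((\sum_(i < n) tnth v i ^+ 2) / u j) `^ p.
pose Y j t := Num.max 1 (X j t / u j) `^ p.
have yY j t : y j (col_tuple (W t) j) = Y j t.
  rewrite /y /Y /X l2norm_sqr; congr (Num.max _ (_ / _) `^ _).
  by apply: eq_bigr => i _; rewrite tnth_mktuple mxE.
have EXp' j : (\int[P]_t (X j t `^ p)%:E <= (u j `^ p)%:E)%E.
  have := EXp j; rewrite mE -EFinM poweR_EFin; apply: le_trans.
  rewrite EE le_eqVlt; apply/orP; left; apply/eqP; apply: eq_integral => t _.
  rewrite /X -powR_mulrn ?sqrtr_ge0// -powRrM; congr ((_ `^ _)%:E).
  by rewrite /p; field.
have EY j : (\int[P]_t (Y j t)%:E <= 2%:E)%E.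
  by apply: integral_max_powR_le2 => //; exact: ltW.
have prodY : (\int[P]_t (\prod_j Y j t)%:E <= (2 ^+ d)%:E)%E.
  under eq_integral => t _ do under eq_bigr do rewrite -yY.
  rewrite (@integral_prod_indep _ _ _ _ _ P _ (fun j t => col_tuple (W t) j) y)//.
  - rewrite (_ : 2 ^+ d = \prod_(j < d) 2); last by rewrite prodr_const card_ord.
    rewrite -prodEFin; pose z j := (\int[P]_t (Y j t)%:E)%E.
    under eq_bigr => j _ do under eq_integral do rewrite yY.
    suff [] : (0 <= \prod_(j < d) z j)%E /\
              (\prod_(j < d) z j <= \prod_(j < d) 2%:E)%E by [].
    elim/big_rec2: _ => [|j v w _ [w0 vw]]; first by rewrite lee01.
    have z0 : (0 <= z j)%E by apply: integral_ge0 => t _; rewrite lee_fin powR_ge0.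
    by rewrite mule_ge0// lee_pmul// EY.
  - move=> j; apply/measurable_fun_tnthP => i.
    rewrite (_ : _ \o _ = fun t => W t i j); first exact: mW.
    by apply/funext => t /=; rewrite tnth_mktuple.
  - move=> j; apply: (measurableT_comp (measurable_powR _)).
    apply: measurable_maxr => //; apply: measurable_funM => //.
    apply: measurable_sum => i; apply: measurable_funX; exact: measurable_tnth.
  - by move=> j v; rewrite powR_ge0.
  - move=> j; under eq_integral do rewrite yY.
    by rewrite (le_lt_trans (EY j))// ltry.
(* Since [C > 0], [u j = 0] forces the nonnegative [X j] to have mean 0, so it vanishes almost
   surely. Hence the comparison with the product below holds only almost everywhere. *)
have X_ae : {ae P, forall t, forall j, u j = 0 -> l2norm (col j (W t)) = 0}.
  apply: filter_forall => j.
  have [uj0|ujN0] := eqVneq (u j) 0; last first.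
    by apply: aeW => t uj; rewrite uj eqxx in ujN0.
  have mj0 : m j = 0 by apply/eqP; move/eqP: uj0; rewrite mulf_eq0 gt_eqF.
  have : (\int[P]_t `|(X j t)%:E| = 0)%E.
    under eq_integral do rewrite gee0_abs ?lee_fin//.
    by rewrite -EE mE mj0.
  move/ae_eq_integral_abs => /(_ measurableT) h.
  have {h} : ae_eq P [set: T] (fun t => (X j t)%:E) (cst 0%E).
    by apply: h; exact/measurable_EFinP.
  apply: filterS => t /= /(_ I) [/eqP]; rewrite sqrf_eq0 => /eqP Xt _.
  exact: Xt.
pose q := (2 + beta) * d%:R.
have kp0 : 0 < kappa by exact: lt_trans k1.
have kq0 : 0 < kappa `^ q by rewrite powR_gt0.
have kqE : (kappa ^+ (2 * d)) `^ p = kappa `^ q.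
  rewrite -powR_mulrn ?ltW// -powRrM; congr (_ `^ _).
  by rewrite natrM /p /q; field.
(* Markov's inequality, by integrating the almost sure bound of [kappa^q] times the indicator of [A]
   by the product of the [Y j]. *)
have PA : ((kappa `^ q)%:E * P A <= (2 ^+ d)%:E)%E.
  apply: le_trans prodY.
  rewrite -[in P A](setIT A) -integral_indic// -ge0_integralZl//; last 2 first.
  - by apply/measurable_EFinP; exact: measurable_indic.
  - by rewrite lee_fin ltW.
  have mY j : measurable_fun [set: T] (Y j).
    apply: (measurableT_comp (measurable_powR _)).
    by apply: measurable_maxr => //; exact: measurable_funM.
  apply: ae_ge0_le_integral => //.
  - by move=> t _; rewrite -EFinM lee_fin mulr_ge0// ltW.
  - by apply/measurable_EFinP; apply: measurable_funM => //; exact: measurable_indic.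
  - by move=> t _; rewrite lee_fin; apply: prodr_ge0 => j _; rewrite powR_ge0.
  - by apply/measurable_EFinP; exact: measurable_prod.
  apply: filterS X_ae => t Xt _; rewrite -EFinM lee_fin.
  rewrite indicE; have [At|nAt] := pselect (A t); last first.
    by rewrite memNset// mulr0; apply: prodr_ge0 => j _; rewrite powR_ge0.
  rewrite mem_set// mulr1 -kqE powR_prod => [|j]; last by rewrite le_max ler01.
  apply: ge0_ler_powR; rewrite ?nnegrE ?exprn_ge0 ?(ltW p0) ?(ltW kp0)//.
    by apply: prodr_ge0 => j _; rewrite le_max ler01.
  exact: regHS_ge_prod.
have : (P A <= (2 ^+ d / kappa `^ q)%:E)%E.
  by rewrite EFinM lee_pdivlMr// muleC.
move=> /le_trans; apply; rewrite lee_fin -/q powRM ?invr_ge0 ?(ltW kp0)//.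
rewrite [kappa `^ (- q)]powRN ler_pM2r ?invr_gt0//.
(* What remains is [2^d <= 2^q], which holds because [q = (2 + beta) d >= d]. *)
rewrite -[2^-1]powR_inv1// -powRrM mulrNN mul1r -powR_mulrn//.
apply: ler_powR; first by rewrite ler1n.
rewrite /q -[leLHS]mul1r ler_wpM2r// ; lra.
Qed.
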